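(* Let $k,r$ be rational numbers with $r\neq0$, let $\varepsilon\in\{1,-1\}$, put $t=rk^6$ and $$m=\frac{k}{r}(t-7\varepsilon).$$ Then the following two tuples $(s_0,\dots,s_6)$ are mutually conjugate solutions of $|F(7,m)|=1$: (1) $s_0=1,\ s_1=-\varepsilon rk^5,\ s_2=3\varepsilon rk^4,\ s_3=-5\varepsilon rk^3,\ s_4=5\varepsilon rk^2,\ s_5=-3\varepsilon rk,\ s_6=\varepsilon r$; (2) $$\begin{aligned} s_0&=t^6-21\varepsilon t^5+161t^4-539\varepsilon t^3+721t^2-245\varepsilon t+1,\\ s_1&=rk^5(t^5-20\varepsilon t^4+144t^3-442\varepsilon t^2+516t-132\varepsilon),\\ s_2&=rk^4(t^5-19\varepsilon t^4+128t^3-358\varepsilon t^2+360t-66\varepsilon),\\ s_3&=rk^3(t^5-18\varepsilon t^4+113t^3-286\varepsilon t^2+244t-30\varepsilon),\\ s_4&=rk^2(t^5-17\varepsilon t^4+99t^3-225\varepsilon t^2+160t-12\varepsilon),\\ s_5&=rk(t^5-16\varepsilon t^4+86t^3-174\varepsilon t^2+101t-4\varepsilon),\\ s_6&=r(t^5-15\varepsilon t^4+74t^3-132\varepsilon t^2+61t-\varepsilon). \end{aligned}$$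
   Context: For $N\ge1$ and a tuple $s=(s_0,\dots,s_{N-1})$ let $X(s)$ be the $N\times N$ matrix with (indices $0\le i,j\le N-1$) entry $s_{i-j}$ if $i\ge j$ and $m\,s_{N+i-j}$ if $i<j$; it is the matrix of the form $s_0+s_1\sqrt[N]{m}+\dots+s_{N-1}\sqrt[N]{m^{N-1}}$. The norm is $|F(N,m)|=\det X(s)$. Tuples $s,\overline{s}$ are conjugate if $X(s)X(\overline{s})=|F(N,m)|\cdot E$, with $E$ the identity matrix. Here $N=7$. *)

(* Defs.v *)
From mathcomp Require Import all_boot all_order all_algebra.

Set Implicit Arguments.
Unset Strict Implicit.
Unset Printing Implicit Defensive.

Import GRing.Theory.
Local Open Scope ring_scope.

(* The matrix X(s) attached to s_0 + s_1 m^(1/N) + ... + s_(N-1) m^((N-1)/N).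
   Both differences of indices are natural numbers smaller than N, so neither
   the truncated subtraction nor the default value of nth plays any role. *)
Definition radical_mx (R : comNzRingType) (N : nat) (m : R) (s : N.-tuple R) :
    'M[R]_N :=
  \matrix_(i < N, j < N)
    if (j <= i)%N then nth 0 s (i - j)%N else m * nth 0 s (N + i - j)%N.

(* |F(N, m)| at s: a signed determinant, no absolute value is involved. *)
Definition radical_norm (R : comNzRingType) (N : nat) (m : R)
    (s : N.-tuple R) : R :=
  \det (radical_mx m s).

(* The norm on the right-hand side is that of the first tuple, so the relation
   is not symmetric by definition. *)
Definition radical_conjugate (R : comNzRingType) (N : nat) (m : R)
    (s s' : N.-tuple R) : Prop :=
  radical_mx m s *m radical_mx m s' = (radical_norm m s)%:M.

(* Main.v *)
Require Import Defs.
From mathcomp Require Import all_boot all_order all_algebra.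
From mathcomp Require Import zify ring.
Import GRing.Theory.
Local Open Scope ring_scope.

(** Let T be the matrix of the N-th root x of m, so that X(s) is the value at T
    of the polynomial with coefficients s ([radical_mx_horner]).  The
    characteristic polynomial of T is X^N - m, hence T^N = m and
    det (T - k) = m - k^N for odd N.

    For the first tuple s, the choice of m gives m - k^7 = - 7 eps k / r, and
    this number is also the common factor of the coefficients of
    (X - k)^7 - (X^7 - m).  The quotient is the polynomial f of s, so
    (m - k^7) f(x) = (x - k)^7.  The determinants of both sides are
    (m - k^7)^7 times the norm of s, and (m - k^7)^7; so the norm of s is 1
    ([radical_norm_root_power], [root_power_tuple_norm]).  This cancellation
    fails for k = 0, where m = 0 and X(s) is unitriangular.

    The second tuple is the inverse of the first one.  The matrices X(s) are
    polynomials in T, and a matrix commuting with T is determined by its first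
    column ([comm_radical_gen_inj]), so that X(s) X(s') = 1 amounts to seven
    identities between rational functions of k and r ([radical_mx_mul1],
    [root_power_tuple_inverse]).  Taking determinants, the norm of s' is 1 as
    well, and conjugacy holds in both orders. *)

(** The matrix of multiplication by the root x on the basis 1, x, ..., x^n.  It
    is given directly rather than as [radical_mx] of the tuple of x because in
    degree n + 1 = 1 there is no coefficient of index 1. *)
Definition radical_gen {R : comNzRingType} {n : nat} (m : R) : 'M[R]_n.+1 :=
  \matrix_(i, j) if i == 0 :> nat then m *+ (j == n :> nat)
                 else (i == j.+1 :> nat)%:R.

(** The transpose of [radical_gen m] is the companion matrix of X^(n+1) - m. *)
Lemma char_poly_radical_gen {R : comNzRingType} {n : nat} (m : R) :
  char_poly (radical_gen m : 'M_n.+1) = 'X^(n.+1) - m%:P.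
Proof.
set p := _ - _.
have -> : char_poly (radical_gen m : 'M_n.+1) =
          char_poly (radical_gen m : 'M_n.+1)^T.
  by rewrite /char_poly -det_tr; congr (\det _); apply/matrixP=> i j;
     rewrite !mxE eq_sym.
have size_p : (size p).-1 = n.+1 by rewrite size_XnsubC.
(* The size of a companion matrix is (size p).-1, which is only provably equal
   to n.+1; an arbitrary size d in its place avoids a cast. *)
have companion_p d (e : (size p).-1 = d) (A : 'M_d) :
    A =2 (fun i j => if i == d.-1 :> nat then - p`_j
                     else (i.+1 == j :> nat)%:R) -> char_poly A = p.
  case: d / e A => A eqA; rewrite -[RHS]companionmxK ?monicXnsubC //.
  by congr char_poly; apply/matrixP=> i j; rewrite eqA mxE.
apply: (companion_p _ size_p) => i j; rewrite !mxE /=.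
rewrite /p coefB coefXn coefC (ltn_eqF (ltn_ord j)) sub0r opprK.
have [->|/negPf j_neq0] := eqVneq (val j) 0%N.
  by case: (val i == n).
rewrite eq_sym; have [->|//] := eqVneq (val i) n.
by rewrite gtn_eqF.
Qed.

(** The characteristic polynomial at k is det (k - T) for T = radical_gen m, so
    that a sign appears for each row. *)
Lemma det_radical_gen_sub {R : comNzRingType} {n : nat} (m k : R) :
  \det (radical_gen m - k%:M : 'M_n.+1) = (-1) ^+ n.+1 * (k ^+ n.+1 - m).
Proof.
have ->: k ^+ n.+1 - m = \det (k%:M - radical_gen m : 'M_n.+1).
  have <-: (char_poly (radical_gen m : 'M_n.+1)).[k] = k ^+ n.+1 - m.
    by rewrite char_poly_radical_gen !hornerE.
  rewrite /char_poly -horner_evalE -det_map_mx; congr (\det _).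
  apply/matrixP=> i j; rewrite !mxE /= horner_evalE !hornerE.
  by rewrite hornerMn hornerX.
by rewrite -detZ scaleN1r opprB.
Qed.

(** Up to degree n, the powers of the root carry one nonzero coefficient, whose
    diagonal re-enters at the top right corner with a factor m. *)
Lemma radical_genX {R : comNzRingType} {n e : nat} (m : R) (a b : 'I_n.+1) :
    (e <= n)%N ->
  (radical_gen m ^+ e) a b =
    if (b <= a)%N then (a - b == e)%N%:R else m *+ (n.+1 + a - b == e)%N.
Proof.
elim: e a b => [|e IHe] a b le_e.
  rewrite expr0 mxE -val_eqE /=; have lt_b := ltn_ord b.
  case: leqP => [le_ba|lt_ab]; first by congr (nat_of_bool _)%:R; lia.
  have -> : (a == b :> nat) = false by lia.
  by have -> : (n.+1 + a - b == 0)%N = false by lia.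
rewrite exprS mxE.
have [a0|a_gt0] := posnP a.
  rewrite (bigD1 ord_max) //= big1 => [|l l_max]; last first.
    by rewrite mxE a0 (_ : _ == n = false) ?mul0r //; apply/negbTE.
  have lt_b := ltn_ord b.
  rewrite addr0 mxE a0 !eqxx mulr1n IHe ?(ltnW le_e) //= -[(b <= n)%N]ltnS lt_b.
  rewrite mulr_natr leqn0; case: posnP => [->|b_gt0].
    by have -> : (n - 0 == e)%N = false by lia.
  by congr (m *+ nat_of_bool _); lia.
have lt_a : (a.-1 < n.+1)%N by rewrite (leq_ltn_trans (leq_pred a)).
rewrite (bigD1 (Ordinal lt_a)) //= big1 => [|l l_a]; last first.
  rewrite mxE (gtn_eqF a_gt0) (_ : _ == _ = false) ?mul0r //.
  by apply: contraNF l_a => /eqP a_l; rewrite -val_eqE /= a_l.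
rewrite addr0 mxE (gtn_eqF a_gt0) /= prednK // eqxx mul1r IHe ?(ltnW le_e) //=.
have lt_b := ltn_ord b.
case: (leqP b a) => [le_ba|lt_ab].
  case: leqP => [le_ba'|lt_ab']; first by congr (nat_of_bool _)%:R; lia.
  have -> : (n.+1 + a.-1 - b == e)%N = false by lia.
  by have -> : (a - b == e.+1)%N = false by lia.
have -> : (b <= a.-1)%N = false by lia.
by congr (m *+ nat_of_bool _); lia.
Qed.

(** The first basis vector is cyclic: its image under the b-th power of
    T = radical_gen m is the b-th basis vector.  So column b of a
    matrix commuting with T is T^b applied to its first column. *)
Lemma comm_radical_gen_inj {R : comNzRingType} {n : nat} (m : R)
    (A B : 'M[R]_n.+1) :
    GRing.comm A (radical_gen m) -> GRing.comm B (radical_gen m) ->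
    col 0 A = col 0 B -> A = B.
Proof.
have entryE (C : 'M[R]_n.+1) a b : GRing.comm C (radical_gen m) ->
    C a b = \sum_l (radical_gen m ^+ b) a l * col 0 C l 0.
  move=> comC; have -> : C a b = (C * radical_gen m ^+ b) a 0.
    rewrite mxE (bigD1 b) //= big1 => [|l l_b]; rewrite radical_genX ?leq_ord //=.
      by rewrite subn0 eqxx mulr1 addr0.
    by rewrite subn0 val_eqE (negPf l_b) mulr0.
  rewrite (commrX b comC) mxE.
  by apply: eq_bigr => l _; rewrite !mxE.
by move=> comA comB eqAB; apply/matrixP=> a b; rewrite !entryE // eqAB.
Qed.

Lemma radical_mx_horner {R : comNzRingType} {n : nat} (m : R)
    (s : n.+1.-tuple R) :
  radical_mx m s = horner_mx (radical_gen m) (\poly_(i < n.+1) s`_i).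
Proof.
rewrite poly_def linear_sum /=; apply/matrixP=> a b; rewrite mxE summxE.
have lt_a := ltn_ord a; have lt_b := ltn_ord b.
under eq_bigr => i _.
  rewrite linearZ /= rmorphXn /= horner_mx_X mxE radical_genX ?leq_ord //; over.
case: leqP => [le_ba|lt_ab].
  have lt_ab : (a - b < n.+1)%N by lia.
  rewrite (bigD1 (Ordinal lt_ab)) //= eqxx mulr1 big1 ?addr0 // => i i_ab.
  by move: i_ab; rewrite -val_eqE /= eq_sym => /negPf->; rewrite mulr0.
have lt_abn : (n.+1 + a - b < n.+1)%N by lia.
rewrite (bigD1 (Ordinal lt_abn)) //= eqxx mulrC big1 ?addr0 // => i i_ab.
by move: i_ab; rewrite -val_eqE /= eq_sym => /negPf->; rewrite mulr0n mulr0.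
Qed.

Lemma comm_radical_mx {R : comNzRingType} {n : nat} (m : R)
    (s : n.+1.-tuple R) :
  GRing.comm (radical_mx m s) (radical_gen m).
Proof.
rewrite radical_mx_horner -[X in GRing.comm _ X]horner_mx_X /GRing.comm.
by rewrite -!rmorphM /= mulrC.
Qed.

Lemma radical_mx_comm {R : comNzRingType} {n : nat} (m : R)
    (s s' : n.+1.-tuple R) :
  radical_mx m s *m radical_mx m s' = radical_mx m s' *m radical_mx m s.
Proof. by rewrite !radical_mx_horner !mulmxE -!rmorphM /= mulrC. Qed.

(** Since the product commutes with [radical_gen m], it suffices to compare its
    first column with that of the identity; the first column of X(s') is s'. *)
Lemma radical_mx_mul1 {R : comNzRingType} {n : nat} (m : R)
    (s s' : n.+1.-tuple R) :
    (forall i, \sum_j radical_mx m s i j * s'`_j = (i == 0)%:R) ->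
  radical_mx m s *m radical_mx m s' = 1%:M.
Proof.
move=> prod_ss'; apply: (@comm_radical_gen_inj _ _ m).
- by apply/commr_sym/commrM; apply/commr_sym/comm_radical_mx.
- exact: commr_sym (commr1 _).
apply/colP=> i; rewrite !mxE -prod_ss'; apply: eq_bigr => j _.
by rewrite [radical_mx m s' _ _]mxE subn0.
Qed.

(** By Cayley-Hamilton, the hypothesis says that (m - k^N) X(s) = (T - k)^N
    for T = radical_gen m and N = n + 1, where det (T - k) = m - k^N
    because N is odd.  Both determinants are then (m - k^N)^N up to the norm of
    s. *)
Lemma radical_norm_root_power {F : fieldType} {n : nat} (m k : F)
    (s : n.+1.-tuple F) :
    odd n.+1 -> m - k ^+ n.+1 != 0 ->
    (m - k ^+ n.+1) *: \poly_(i < n.+1) s`_i =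
      ('X - k%:P) ^+ n.+1 - ('X^(n.+1) - m%:P) ->
  radical_norm m s = 1.
Proof.
move=> odd_n; set c := m - _ => c_neq0 def_s.
have scaled_s : c *: radical_mx m s = (radical_gen m - k%:M) ^+ n.+1.
  rewrite radical_mx_horner -linearZ /= def_s.
  rewrite -[in 'X^(n.+1) - _](char_poly_radical_gen m) rmorphB /=.
  rewrite Cayley_Hamilton subr0 rmorphXn rmorphB /=.
  by rewrite horner_mx_X horner_mx_C.
have det_c : \det (radical_gen m - k%:M : 'M_n.+1) = c.
  by rewrite det_radical_gen_sub -signr_odd odd_n mulN1r opprB.
have det_exp e : \det ((radical_gen m - k%:M : 'M_n.+1) ^+ e) = c ^+ e.
  elim: e => [|e IHe]; first by rewrite !expr0 det1.
  by rewrite !exprS -mulmxE det_mulmx IHe det_c.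
have := congr1 determinant scaled_s; rewrite detZ det_exp -[RHS]mulr1.
exact/mulfI/expf_neq0.
Qed.

(** The coefficients of ((X - k)^7 - (X^7 - m)) / (m - k^7), where
    m - k^7 = - 7 eps k / r and eps is its own inverse. *)
Definition root_power_tuple {F : fieldType} (k r eps : F) : 7.-tuple F :=
  [tuple 1;
         - eps * r * k ^+ 5;
         3 * eps * r * k ^+ 4;
         - 5 * eps * r * k ^+ 3;
         5 * eps * r * k ^+ 2;
         - 3 * eps * r * k;
         eps * r].

(** The inverse of the previous element, which is g^7 / (m - k^7)^6 for
    g = k^6 + k^5 x + ... + x^6 when the denominator is not zero, since
    (x - k) g = m - k^7. *)
Definition root_power_inverse_tuple {F : fieldType} (k r eps : F) :
    7.-tuple F :=
  let t := r * k ^+ 6 in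
  [tuple t ^+ 6 - 21 * eps * t ^+ 5 + 161 * t ^+ 4 - 539 * eps * t ^+ 3
           + 721 * t ^+ 2 - 245 * eps * t + 1;
         r * k ^+ 5 * (t ^+ 5 - 20 * eps * t ^+ 4 + 144 * t ^+ 3
           - 442 * eps * t ^+ 2 + 516 * t - 132 * eps);
         r * k ^+ 4 * (t ^+ 5 - 19 * eps * t ^+ 4 + 128 * t ^+ 3
           - 358 * eps * t ^+ 2 + 360 * t - 66 * eps);
         r * k ^+ 3 * (t ^+ 5 - 18 * eps * t ^+ 4 + 113 * t ^+ 3
           - 286 * eps * t ^+ 2 + 244 * t - 30 * eps);
         r * k ^+ 2 * (t ^+ 5 - 17 * eps * t ^+ 4 + 99 * t ^+ 3
           - 225 * eps * t ^+ 2 + 160 * t - 12 * eps);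
         r * k * (t ^+ 5 - 16 * eps * t ^+ 4 + 86 * t ^+ 3
           - 174 * eps * t ^+ 2 + 101 * t - 4 * eps);
         r * (t ^+ 5 - 15 * eps * t ^+ 4 + 74 * t ^+ 3
           - 132 * eps * t ^+ 2 + 61 * t - eps)].

Lemma root_power_tuple_inverse {F : fieldType} (k r eps : F) :
    r != 0 -> eps = 1 \/ eps = -1 ->
  let m := k / r * (r * k ^+ 6 - 7 * eps) in
  radical_mx m (root_power_tuple k r eps) *m
    radical_mx m (root_power_inverse_tuple k r eps) = 1%:M.
Proof.
move=> r_neq0 eps_sign m; apply: radical_mx_mul1 => i.
do 7![rewrite big_ord_recl]; rewrite big_ord0 !mxE /=.
case: i => -[|[|[|[|[|[|[|//]]]]]]] i_lt /=; rewrite /bump /=;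
  rewrite /m; case: eps_sign => ->; by field.
Qed.

(** Where 7 = 0 the factor m - k^7 = - 7 eps k / r vanishes for every k and
    cannot be cancelled. *)
Lemma root_power_tuple_norm {F : fieldType} (k r eps : F) :
    (7 : F) != 0 -> r != 0 -> eps = 1 \/ eps = -1 ->
  radical_norm (k / r * (r * k ^+ 6 - 7 * eps)) (root_power_tuple k r eps) = 1.
Proof.
move=> neq0_7 r_neq0 eps_sign; set m := k / r * _.
(* For k = 0, also m = 0 and the entries above the diagonal vanish. *)
have [k0|k_neq0] := eqVneq k 0.
  rewrite /radical_norm det_trig; last first.
    apply/is_trig_mxP=> i j lt_ij; rewrite mxE leqNgt lt_ij /=.
    by rewrite /m k0 !mul0r.
  by rewrite big1 // => i _; rewrite mxE leqnn subnn.
have m_k7 : m - k ^+ 7 = - 7 * eps * (k / r) by rewrite /m; field.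
apply: (radical_norm_root_power m k) => //.
  rewrite m_k7 !mulf_neq0 ?oppr_eq0 ?invr_eq0 //.
  by case: eps_sign => ->; rewrite ?oppr_eq0 oner_neq0.
rewrite m_k7 poly_def; do 7![rewrite big_ord_recr]; rewrite big_ord0 /=.
rewrite /m -!mul_polyC.
(* With k = u r, both sides are polynomials in u, r and X: no inverse is left. *)
have [u ->] : exists u, k = u * r by exists (k / r); rewrite divfK.
by rewrite mulfK //; case: eps_sign => ->; ring.
Qed.

Theorem mainTheorem6 (k r eps : rat) (hr : r != 0)
    (heps : eps = 1 \/ eps = -1) :
  let t : rat := r * k ^+ 6 in
  let m : rat := k / r * (t - 7 * eps) in
  let s : 7.-tuple rat :=
    [tuple 1;
           - eps * r * k ^+ 5;
           3 * eps * r * k ^+ 4;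
           - 5 * eps * r * k ^+ 3;
           5 * eps * r * k ^+ 2;
           - 3 * eps * r * k;
           eps * r] in
  let s' : 7.-tuple rat :=
    [tuple t ^+ 6 - 21 * eps * t ^+ 5 + 161 * t ^+ 4 - 539 * eps * t ^+ 3
             + 721 * t ^+ 2 - 245 * eps * t + 1;
           r * k ^+ 5 * (t ^+ 5 - 20 * eps * t ^+ 4 + 144 * t ^+ 3
             - 442 * eps * t ^+ 2 + 516 * t - 132 * eps);
           r * k ^+ 4 * (t ^+ 5 - 19 * eps * t ^+ 4 + 128 * t ^+ 3
             - 358 * eps * t ^+ 2 + 360 * t - 66 * eps);
           r * k ^+ 3 * (t ^+ 5 - 18 * eps * t ^+ 4 + 113 * t ^+ 3
             - 286 * eps * t ^+ 2 + 244 * t - 30 * eps);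
           r * k ^+ 2 * (t ^+ 5 - 17 * eps * t ^+ 4 + 99 * t ^+ 3
             - 225 * eps * t ^+ 2 + 160 * t - 12 * eps);
           r * k * (t ^+ 5 - 16 * eps * t ^+ 4 + 86 * t ^+ 3
             - 174 * eps * t ^+ 2 + 101 * t - 4 * eps);
           r * (t ^+ 5 - 15 * eps * t ^+ 4 + 74 * t ^+ 3
             - 132 * eps * t ^+ 2 + 61 * t - eps)] in
  [/\ radical_norm m s = 1,
      radical_norm m s' = 1,
      radical_conjugate m s s' &
      radical_conjugate m s' s].
Proof.
move=> t m s s'.
have inv_s : radical_mx m s *m radical_mx m s' = 1%:M.
  exact: root_power_tuple_inverse hr heps.
have norm_s : radical_norm m s = 1.
  exact: root_power_tuple_norm _ hr heps.
clearbody s s' m.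
have norm_s' : radical_norm m s' = 1.
  have := congr1 determinant inv_s.
  by rewrite det_mulmx det1 -/(radical_norm m s) norm_s mul1r.
split=> //; rewrite /radical_conjugate ?norm_s ?norm_s' //.
by rewrite radical_mx_comm.
Qed.
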